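(* Let $\sum_{n=0}^{\infty}a_n$ be a series of non-zero real numbers and let $p\in(0,\infty)$ be the exponent in the definition of $\rho_{\mathrm{mean}}$. Then: (1) If $\rho_{\mathrm{ratio}}=1$, then $\rho_{\mathrm{root}}=1$ and $\rho_{\mathrm{mean}}=1$. (2) If $\rho_{\mathrm{root}}=1$, then either $\rho_{\mathrm{ratio}}=1$ or $\rho_{\mathrm{ratio}}$ does not exist. (3) If $\rho_{\mathrm{mean}}=1$, then either $\rho_{\mathrm{ratio}}=1$ or $\rho_{\mathrm{ratio}}$ does not exist. (4) If $\rho_{\mathrm{root}}$ does not exist, then $\rho_{\mathrm{ratio}}$ does not exist. (5) If $\rho_{\mathrm{mean}}$ does not exist, then $\rho_{\mathrm{ratio}}$ does not exist.
   Context: For a series $\sum_{n=0}^\infty a_n$ of non-zero real numbers and an exponent $p\in(0,\infty)$, define $$\rho_{\mathrm{ratio}}=\lim_{n\to\infty}\frac{|a_{n+1}|}{|a_n|},\qquad \rho_{\mathrm{root}}=\lim_{n\to\infty}\sqrt[n]{|a_n|},\qquad \rho_{\mathrm{mean}}=\lim_{N\to\infty}\sqrt[p]{\frac{1}{N}\sum_{n=1}^{N}\left|\frac{a_n}{a_{n-1}}\right|^p}.$$ Each quantity is said to exist if the corresponding limit exists, finite or infinite (i.e. in $[0,\infty]$); a statement such as $\rho=1$ means that the limit exists and equals $1$. *)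

(* Defs.v *)
From Stdlib Require Import Reals.
From Coquelicot Require Import Coquelicot.
Open Scope R_scope.

(* The quantities rho are the limits, in Rbar, of the sequences below: "rho = l"
   is [is_lim_seq u l] and "rho exists" is [ex_lim_seq u], which allows infinite
   limits.  The terms are nonnegative, so a limit in Rbar lies in [0, +oo]. *)

Definition ratio_seq (a : nat -> R) (n : nat) : R :=
  Rabs (a (S n)) / Rabs (a n).

(* [Rpower x y] is x^y only for 0 < x.  When all a_n are nonzero, every base
   below is positive except in [mean_seq] at N = 0.  The terms of [root_seq] and
   [mean_seq] at index 0 are meaningless, and do not affect the limits. *)

Definition root_seq (a : nat -> R) (n : nat) : R :=
  Rpower (Rabs (a n)) (/ INR n).

Definition mean_seq (p : R) (a : nat -> R) (N : nat) : R :=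
  Rpower
    (/ INR N * sum_n_m (fun n => Rpower (Rabs (a n / a (n - 1)%nat)) p) 1 N)
    (/ p).

(* Main.v *)
Require Import Defs.
From Stdlib Require Import Reals Lra Lia.
From Coquelicot Require Import Coquelicot.
Open Scope R_scope.

(** All five claims follow from one fact: if the ratios [r n = |a (n+1)| / |a n|]
    tend to [l] in [0, +oo], then so do the roots and the means
    ([root_lim], [mean_lim]).  Claims (1), (4) and (5) are instances of it or
    contrapositives, and (2) and (3) add the uniqueness of limits.

    That fact is Cesaro's theorem, valid for infinite limits as well
    ([cesaro_lim]), in a change of variables.  The root is a geometric mean:
    [ln |a N| / N] is [ln |a 0| / N] plus the average of the first [N] values
    [ln (r n)].  The mean is the arithmetic mean of the [r n ^ p], to the power
    [1 / p].  To treat the limits [0] and [+oo] together with the positive finite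
    ones, every power is written as an exponential, and [exp] is extended to an
    order isomorphism [Rbar_exp] from [-oo, +oo] onto [0, +oo]: a sequence tends
    to [L] exactly when its exponential tends to [Rbar_exp L] ([exp_lim]). *)

(** A limit in [Rbar] is a statement about the order alone.  This form avoids a
    case distinction on whether the limit is finite. *)
Lemma is_lim_seq_order (u : nat -> R) (L : Rbar) :
  is_lim_seq u L <->
  (forall c : R, Rbar_lt c L -> eventually (fun n => c < u n)) /\
  (forall c : R, Rbar_lt L c -> eventually (fun n => u n < c)).
Proof.
split.
- intros H; apply is_lim_seq_spec in H; destruct L as [l | | ]; simpl in H;
    split; intros c Hc; simpl in Hc; try easy.
  + assert (He : 0 < l - c) by lra.
    apply filter_imp with (2 := H (mkposreal _ He)); simpl.
    intros n Hn; apply Rabs_def2 in Hn; lra.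
  + assert (He : 0 < c - l) by lra.
    apply filter_imp with (2 := H (mkposreal _ He)); simpl.
    intros n Hn; apply Rabs_def2 in Hn; lra.
- intros [Hlow Hup]; apply is_lim_seq_spec; destruct L as [l | | ]; simpl.
  + intros [e He]; simpl.
    assert (Hl : Rbar_lt (l - e) l) by (simpl; lra).
    assert (Hu : Rbar_lt l (l + e)) by (simpl; lra).
    generalize (filter_and _ _ (Hlow _ Hl) (Hup _ Hu)); apply filter_imp.
    intros n [H1 H2]; apply Rabs_def1; lra.
  + intros M; now apply Hlow.
  + intros M; now apply Hup.
Qed.

(** * Exponentials of limits *)

Definition Rbar_exp (L : Rbar) : Rbar :=
  match L with
  | Finite x => exp x
  | p_infty => p_infty
  | m_infty => 0
  end.

Lemma Rbar_exp_lt_l (c : R) (L : Rbar) :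
  Rbar_lt (exp c) (Rbar_exp L) <-> Rbar_lt c L.
Proof.
destruct L as [l | | ]; simpl.
- split; [apply exp_lt_inv | apply exp_increasing].
- tauto.
- pose proof (exp_pos c); split; [lra | easy].
Qed.

Lemma Rbar_exp_lt_r (c : R) (L : Rbar) :
  Rbar_lt (Rbar_exp L) (exp c) <-> Rbar_lt L c.
Proof.
destruct L as [l | | ]; simpl.
- split; [apply exp_lt_inv | apply exp_increasing].
- tauto.
- pose proof (exp_pos c); split; [easy | lra].
Qed.

Lemma Rbar_exp_ge_0 (L : Rbar) : Rbar_le 0 (Rbar_exp L).
Proof.
destruct L as [l | | ]; simpl; [left; apply exp_pos | easy | lra].
Qed.

Lemma Rbar_exp_surj (l : Rbar) :
  Rbar_le 0 l -> exists L, l = Rbar_exp L.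
Proof.
destruct l as [l | | ]; simpl; intros Hl.
- destruct Hl as [Hl | <-].
  + exists (Finite (ln l)); simpl; now rewrite exp_ln.
  + now exists m_infty.
- now exists p_infty.
- easy.
Qed.

Lemma exp_lim (v : nat -> R) (L : Rbar) :
  is_lim_seq (fun n => exp (v n)) (Rbar_exp L) <-> is_lim_seq v L.
Proof.
rewrite !is_lim_seq_order; split; intros [Hlow Hup]; split; intros c Hc.
- apply Rbar_exp_lt_l, Hlow in Hc; revert Hc; apply filter_imp.
  intros n; apply exp_lt_inv.
- apply Rbar_exp_lt_r, Hup in Hc; revert Hc; apply filter_imp.
  intros n; apply exp_lt_inv.
- destruct (Rlt_le_dec 0 c) as [Hpos | Hneg].
  + rewrite <- (exp_ln c Hpos) in Hc |- *.
    apply Rbar_exp_lt_l, Hlow in Hc; revert Hc; apply filter_imp.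
    intros n; apply exp_increasing.
  + apply filter_forall; intros n; pose proof (exp_pos (v n)); lra.
- (* Above the nonnegative [Rbar_exp L], the bound [c] has a logarithm. *)
  assert (Hpos : 0 < c) by exact (Rbar_le_lt_trans 0 _ c (Rbar_exp_ge_0 L) Hc).
  rewrite <- (exp_ln c Hpos) in Hc |- *.
  apply Rbar_exp_lt_r, Hup in Hc; revert Hc; apply filter_imp.
  intros n; apply exp_increasing.
Qed.

Lemma ln_lim (r : nat -> R) (L : Rbar) :
  (forall n, 0 < r n) ->
  is_lim_seq r (Rbar_exp L) -> is_lim_seq (fun n => ln (r n)) L.
Proof.
intros Hr H; apply exp_lim; revert H; apply is_lim_seq_ext.
intros n; symmetry; now apply exp_ln.
Qed.

Lemma pos_lim_exp (r : nat -> R) (l : Rbar) :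
  (forall n, 0 < r n) -> is_lim_seq r l -> exists L, l = Rbar_exp L.
Proof.
intros Hr H; apply Rbar_exp_surj.
apply (is_lim_seq_le (fun _ => 0) r); [ | apply is_lim_seq_const | exact H].
intros n; now left.
Qed.

(** * Averages *)

(** The indices run from [1] to [N], shifted back inside, so that for the
    ratios the term of index [n] is [|a n| / |a (n-1)|], as in [mean_seq]. *)
Definition average (u : nat -> R) (N : nat) : R :=
  / INR N * sum_n_m (fun n => u (n - 1)%nat) 1 N.

Lemma sum_shift_S (u : nat -> R) (N : nat) :
  sum_n_m (fun n => u (n - 1)%nat) 1 (S N) =
  sum_n_m (fun n => u (n - 1)%nat) 1 N + u N.
Proof.
rewrite sum_n_Sm by lia; unfold plus; simpl; now rewrite Nat.sub_0_r.
Qed.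

Lemma sum_shift_0 (u : nat -> R) : sum_n_m (fun n => u (n - 1)%nat) 1 0 = 0.
Proof. rewrite sum_n_m_zero by lia; reflexivity. Qed.

Lemma is_lim_seq_div_INR (K : R) : is_lim_seq (fun n => / INR n * K) 0.
Proof.
replace (Finite 0) with (Rbar_mult 0 K) by (simpl; f_equal; ring).
apply is_lim_seq_scal_r.
replace (Finite 0) with (Rbar_inv p_infty) by reflexivity.
apply is_lim_seq_inv; [apply is_lim_seq_INR | easy].
Qed.

(** Once [u] stays above [d], the excess of its sum over [N * d] can only grow,
    hence is bounded below; dividing by [N] makes that bound negligible. *)
Lemma average_eventually_gt (u : nat -> R) (c d : R) :
  c < d -> eventually (fun n => d < u n) ->
  eventually (fun N => c < average u N).
Proof.
intros Hcd [n0 Hn0].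
set (s := sum_n_m (fun n => u (n - 1)%nat) 1).
set (K := s n0 - INR n0 * d).
assert (HK : forall N, (n0 <= N)%nat -> K <= s N - INR N * d).
{ intros N HN; induction HN as [ | N HN IH]; [unfold K; lra | ].
  unfold s in *; rewrite sum_shift_S, S_INR; specialize (Hn0 N HN); lra. }
destruct (proj1 (is_lim_seq_order _ _) (is_lim_seq_div_INR K)) as [Hlow _].
assert (Hneg : Rbar_lt (c - d) 0) by (simpl; lra).
destruct (Hlow _ Hneg) as [n1 Hn1].
exists (S (n0 + n1)); intros N HN.
assert (HINR : 0 < INR N) by (apply lt_0_INR; lia).
specialize (HK N ltac:(lia)); specialize (Hn1 N ltac:(lia)).
unfold average; fold s.
apply Rmult_le_compat_l with (r := / INR N) in HK;
  [ | left; now apply Rinv_0_lt_compat].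
replace (/ INR N * (s N - INR N * d)) with (/ INR N * s N - d) in HK
  by (field; lra).
lra.
Qed.

Lemma average_opp (u : nat -> R) (N : nat) :
  average (fun n => - u n) N = - average u N.
Proof.
unfold average.
enough (H : sum_n_m (fun n => - u (n - 1)%nat) 1 N
            = - sum_n_m (fun n => u (n - 1)%nat) 1 N :> R) by (rewrite H; ring).
induction N as [ | N IH].
- rewrite sum_shift_0, (sum_shift_0 (fun n => - u n)); ring.
- rewrite sum_shift_S, (sum_shift_S (fun n => - u n)), IH; ring.
Qed.

Lemma average_pos (u : nat -> R) (N : nat) :
  (forall n, 0 < u n) -> 0 < average u (S N).
Proof.
intros Hu; unfold average; apply Rmult_lt_0_compat.
- apply Rinv_0_lt_compat, lt_0_INR; lia.
- induction N as [ | N IH]; rewrite sum_shift_S.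
  + rewrite sum_shift_0; specialize (Hu 0%nat); lra.
  + specialize (Hu (S N)); lra.
Qed.

Lemma Rbar_lt_dense (c : R) (L : Rbar) :
  Rbar_lt c L -> exists d : R, c < d /\ Rbar_lt d L.
Proof.
destruct L as [l | | ]; simpl; intros H.
- exists ((c + l) / 2); lra.
- exists (c + 1); split; [lra | easy].
- easy.
Qed.

(** The lower bounds that define the limit pass to the averages, up to an
    arbitrarily small loss; the upper bounds are the same statement for [- u]. *)
Lemma cesaro_lim (u : nat -> R) (L : Rbar) :
  is_lim_seq u L -> is_lim_seq (average u) L.
Proof.
assert (Hlower : forall (v : nat -> R) (M : Rbar) (c : R), is_lim_seq v M ->
  Rbar_lt c M -> eventually (fun N => c < average v N)).
{ intros v M c Hv Hc; destruct (Rbar_lt_dense c M Hc) as [d [Hcd Hd]].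
  apply average_eventually_gt with d; [easy | ].
  now apply (proj1 (is_lim_seq_order v M)). }
intros Hu; apply is_lim_seq_order; split; intros c Hc.
- now apply Hlower with L.
- assert (Hopp : Rbar_lt (- c) (Rbar_opp L))
    by (destruct L; simpl in *; [lra | easy | easy]).
  generalize (Hlower _ _ _ (proj1 (is_lim_seq_opp u L) Hu) Hopp).
  apply filter_imp; intros N; rewrite average_opp; lra.
Qed.

(** * Roots and means of the ratios *)

Lemma ratio_seq_pos (a : nat -> R) (ha : forall n, a n <> 0) (n : nat) :
  0 < ratio_seq a n.
Proof. apply Rdiv_lt_0_compat; now apply Rabs_pos_lt. Qed.

(** The ratios telescope, and [ln] turns their product into a sum. *)
Lemma root_seq_average (a : nat -> R) (ha : forall n, a n <> 0) (N : nat) :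
  root_seq a N =
  exp (/ INR N * ln (Rabs (a 0%nat)) + average (fun n => ln (ratio_seq a n)) N).
Proof.
unfold root_seq, Rpower, average; f_equal.
rewrite <- Rmult_plus_distr_l; f_equal.
induction N as [ | N IH].
- rewrite (sum_shift_0 (fun n => ln (ratio_seq a n))); ring.
- rewrite (sum_shift_S (fun n => ln (ratio_seq a n))), <- Rplus_assoc, <- IH.
  unfold ratio_seq; rewrite ln_div by now apply Rabs_pos_lt.
  ring.
Qed.

Lemma root_lim (a : nat -> R) (ha : forall n, a n <> 0) (l : Rbar) :
  is_lim_seq (ratio_seq a) l -> is_lim_seq (root_seq a) l.
Proof.
intros Hl.
destruct (pos_lim_exp _ _ (ratio_seq_pos a ha) Hl) as [L ->].
apply is_lim_seq_ext with (1 := fun N => eq_sym (root_seq_average a ha N)).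
apply exp_lim.
apply is_lim_seq_plus with (1 := is_lim_seq_div_INR _)
  (2 := cesaro_lim _ _ (ln_lim _ _ (ratio_seq_pos a ha) Hl)).
destruct L; unfold is_Rbar_plus; simpl; now rewrite ?Rplus_0_l.
Qed.

Lemma mean_seq_average (p : R) (a : nat -> R) (ha : forall n, a n <> 0) (N : nat) :
  mean_seq p a N =
  exp (/ p * ln (average (fun n => exp (p * ln (ratio_seq a n))) N)).
Proof.
unfold mean_seq, average; unfold Rpower at 1.
do 4 f_equal; apply sum_n_m_ext_loc; intros n Hn.
unfold Rpower, ratio_seq.
replace (S (n - 1)) with n by lia.
now rewrite Rabs_div by apply ha.
Qed.

Lemma Rbar_mult_pos_p_infty (q : R) : 0 < q -> Rbar_mult q p_infty = p_infty.
Proof.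
intros Hq; apply is_Rbar_mult_unique, is_Rbar_mult_sym.
now apply is_Rbar_mult_p_infty_pos.
Qed.

Lemma Rbar_mult_pos_m_infty (q : R) : 0 < q -> Rbar_mult q m_infty = m_infty.
Proof.
intros Hq; apply is_Rbar_mult_unique, is_Rbar_mult_sym.
now apply is_Rbar_mult_m_infty_pos.
Qed.

(** In the logarithmic scale the two powers multiply the limit [L] by [p] and by
    [/ p]; the average between them keeps the limit. *)
Lemma mean_lim (p : R) (a : nat -> R) (ha : forall n, a n <> 0) (hp : 0 < p)
    (l : Rbar) :
  is_lim_seq (ratio_seq a) l -> is_lim_seq (mean_seq p a) l.
Proof.
intros Hl.
destruct (pos_lim_exp _ _ (ratio_seq_pos a ha) Hl) as [L ->].
apply is_lim_seq_ext with (1 := fun N => eq_sym (mean_seq_average p a ha N)).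
apply exp_lim.
set (w := fun n => exp (p * ln (ratio_seq a n))).
assert (Hw : is_lim_seq w (Rbar_exp (Rbar_mult p L))).
{ apply exp_lim, is_lim_seq_scal_l, ln_lim; [now apply ratio_seq_pos | exact Hl]. }
assert (Havg : is_lim_seq (fun N => ln (average w N)) (Rbar_mult p L)).
{ (* The average of no terms is 0, where [ln] is of no use: shift the index. *)
  apply is_lim_seq_incr_1, (ln_lim (fun N => average w (S N))).
  - intros N; apply average_pos; intros n; apply exp_pos.
  - apply -> is_lim_seq_incr_1; now apply cesaro_lim. }
replace L with (Rbar_mult (/ p) (Rbar_mult p L)); [now apply is_lim_seq_scal_l | ].
assert (hp' : 0 < / p) by now apply Rinv_0_lt_compat.
destruct L as [x | | ].
- simpl; f_equal; field; lra.
- now rewrite !Rbar_mult_pos_p_infty.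
- now rewrite !Rbar_mult_pos_m_infty.
Qed.

Lemma lim_unique_or_no_lim (u v : nat -> R) (l : Rbar) :
  (forall m : Rbar, is_lim_seq u m -> is_lim_seq v m) ->
  is_lim_seq v l -> is_lim_seq u l \/ ~ ex_lim_seq u.
Proof.
intros Huv Hv; destruct (ex_lim_seq_dec u) as [[m Hm] | Hno]; [left | now right].
replace l with m; [exact Hm | ].
rewrite <- (is_lim_seq_unique _ _ Hv); symmetry.
now apply is_lim_seq_unique, Huv.
Qed.

Theorem corollary3p1 (a : nat -> R) (p : R)
    (ha : forall n : nat, a n <> 0) (hp : 0 < p) :
  (is_lim_seq (ratio_seq a) 1 ->
     is_lim_seq (root_seq a) 1 /\ is_lim_seq (mean_seq p a) 1) /\
  (is_lim_seq (root_seq a) 1 ->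
     is_lim_seq (ratio_seq a) 1 \/ ~ ex_lim_seq (ratio_seq a)) /\
  (is_lim_seq (mean_seq p a) 1 ->
     is_lim_seq (ratio_seq a) 1 \/ ~ ex_lim_seq (ratio_seq a)) /\
  (~ ex_lim_seq (root_seq a) -> ~ ex_lim_seq (ratio_seq a)) /\
  (~ ex_lim_seq (mean_seq p a) -> ~ ex_lim_seq (ratio_seq a)).
Proof.
pose proof (root_lim a ha) as Hroot.
pose proof (mean_lim p a ha hp) as Hmean.
repeat split.
- now apply Hroot.
- now apply Hmean.
- now apply lim_unique_or_no_lim.
- now apply lim_unique_or_no_lim.
- intros Hno [l Hl]; apply Hno; exists l; now apply Hroot.
- intros Hno [l Hl]; apply Hno; exists l; now apply Hmean.
Qed.
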